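(* Let $p\in[1,\infty)$ and assume that $E_p(x_0)<\infty$ for some $x_0\in\mathcal{X}$. Let $(X_n)_{n\in\mathbb{N}}$ be a Wasserstein contractive Markov chain with transition kernel $P$ and unique invariant distribution $\pi$. Then for every $f\in\mathscr{L}_0$ the space $\mathscr{L}_0$ contains exactly one solution $u=u_f$ of Poisson's equation with forcing function $f$, i.e. exactly one $u\in\mathscr{L}_0$ with $u(x)-Pu(x)=f(x)-\pi(f)$ for all $x\in\mathcal{X}$ (where $\pi(f)=0$), and this $u$ satisfies (i) $\|u\|_d\le \Lambda\,\|f\|_d$, and (ii) $\int_{\mathcal{X}}|u(x)|^p\,\pi(dx)\le 2^p\inf_{y\in\mathcal{X}}\left(|u(y)|^p+\|u\|_d^p\,E_p(y)\right)<\infty$.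
   Context: $(\mathcal{X},\rho)$ is a non-trivial (more than one point) Polish space with Borel $\sigma$-algebra $\mathcal{B}(\mathcal{X})$, and $d:\mathcal{X}\times\mathcal{X}\to[0,\infty)$ is a metric that is lower semi-continuous with respect to the product topology induced by $\rho$. For probability measures $\mu_1,\mu_2$ on $\mathcal{X}$, $\mathcal{W}(\mu_1,\mu_2)=\inf_{\eta}\int d(x,y)\,\eta(dx,dy)\in[0,\infty]$, the infimum running over all couplings $\eta$ of $\mu_1,\mu_2$. For a Markov kernel $K$ on $\mathcal{X}$, $\tau(K)=\sup_{x\ne y}\mathcal{W}(K(x,\cdot),K(y,\cdot))/d(x,y)$, and $Kf(x)=\int f(x')K(x,dx')$; $K^n$ is the $n$-th iterate, $K^0$ the identity kernel. A Markov chain with transition kernel $P$ is Wasserstein contractive if $\tau(P)<\infty$ and $\tau(P^m)<1$ for some $m\in\mathbb{N}=\{1,2,\dots\}$; in that case $\Lambda:=\sum_{n=0}^\infty\tau(P^n)<\infty$. $\pi(f)=\int f\,d\pi$. A function $f:\mathcal{X}\to\mathbb{R}$ is Lipschitz (w.r.t. $d$) if $\|f\|_d:=\sup_{x\neq y}|f(x)-f(y)|/d(x,y)<\infty$. $\mathscr{L}$ is the space of all measurable Lipschitz functions $f:\mathcal{X}\to\mathbb{R}$, and $\mathscr{L}_0=\{f\in\mathscr{L}:\pi(f)=0\}$. The $p$-eccentricity is $E_p(x)=\int_{\mathcal{X}}d(x,y)^p\,\pi(dy)\in[0,\infty]$. (Under the assumption $E_p(x_0)<\infty$ every $f\in\mathscr{L}$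 is $\pi$-integrable.) *)

(* Defs.v *)
From HB Require Import structures.
From mathcomp Require Import all_boot all_order all_algebra.
From mathcomp Require Import all_classical all_reals all_analysis.

Set Implicit Arguments.
Unset Strict Implicit.
Unset Printing Implicit Defensive.

Import Order.TTheory GRing.Theory Num.Theory.
Import numFieldNormedType.Exports.

Local Open Scope classical_set_scope.
Local Open Scope ring_scope.
Local Open Scope ereal_scope.

(* The metric rho is [mdist]; its topology is the one carried by the type. *)
HB.mixin Record isPolishBorel (disp : measure_display) (R : realType) X
    & Complete X & Metric R X & Measurable disp X := {
  polish_separable : exists2 D : set X, countable D & dense D ;
  polish_borelE : @measurable disp X = <<s @open X >> }.

#[short(type="polishBorelType")]
HB.structure Definition PolishBorel (disp : measure_display) (R : realType) :=
  { X of Complete X & Metric R X & Measurable disp X & isPolishBorel disp R X }.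

Definition is_metric (R : realType) (T : Type) (d : T -> T -> R) : Prop :=
  [/\ forall x y, (0 <= d x y)%R,
      forall x y, d x y = 0%R <-> x = y,
      forall x y, d x y = d y x
    & forall x y z, (d x z <= d x y + d y z)%R].

Section kernel_iterates.
Context (disp : measure_display) (T : measurableType disp) (R : realType).

Section composition.
Variables K L : R.-pker T ~> T.

Let mkcomp_noparam_prob (x : T) : mkcomp_noparam K L x [set: T] = 1.
Proof.
rewrite /mkcomp_noparam /kcomp_noparam/=.
transitivity (\int[K x]_y (cst 1 y : \bar R)).
  by apply: eq_integral => y _; rewrite prob_kernel.
by rewrite integral_cst// mul1e prob_kernel.
Qed.

HB.instance Definition _ := @isProbabilityKernel.Build _ _ _ _ R
  (mkcomp_noparam K L) mkcomp_noparam_prob.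

End composition.

Fixpoint kernel_iter (K : R.-pker T ~> T) (n : nat) : R.-pker T ~> T :=
  if n is m.+1 then mkcomp_noparam K (kernel_iter K m)
  else kdirac (@measurable_id _ T setT).

Definition invariant_distribution (P : R.-pker T ~> T)
    (mu : probability T R) : Prop :=
  forall A, measurable A -> \int[mu]_x P x A = mu A.

Definition unique_invariant_distribution (P : R.-pker T ~> T)
    (pi : probability T R) : Prop :=
  invariant_distribution P pi /\
  forall nu : probability T R, invariant_distribution P nu ->
    forall A, measurable A -> nu A = pi A.

End kernel_iterates.

Section wasserstein.
Context (disp : measure_display) (T : measurableType disp) (R : realType).
Variable d : T -> T -> R.

Definition couplings (mu1 mu2 : {measure set T -> \bar R}) :
    set (probability (T * T)%type R) :=
  [set eta : probability (T * T)%type R |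
    (forall A, measurable A -> eta (A `*` setT) = mu1 A) /\
    (forall A, measurable A -> eta (setT `*` A) = mu2 A)].

Definition wasserstein (mu1 mu2 : {measure set T -> \bar R}) : \bar R :=
  ereal_inf [set \int[eta]_z (d z.1 z.2)%:E | eta in couplings mu1 mu2].

Definition wasserstein_coef (K : R.-pker T ~> T) : \bar R :=
  ereal_sup [set wasserstein (K z.1) (K z.2) / (d z.1 z.2)%:E
            | z in [set z : T * T | z.1 <> z.2]].

Definition wasserstein_contractive (P : R.-pker T ~> T) : Prop :=
  wasserstein_coef P < +oo /\
  exists2 m, (1 <= m)%N & wasserstein_coef (kernel_iter P m) < 1.

Definition wasserstein_sum (P : R.-pker T ~> T) : \bar R :=
  \sum_(0 <= n <oo) wasserstein_coef (kernel_iter P n).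

Definition lip_norm (f : T -> R) : \bar R :=
  ereal_sup [set (`|f z.1 - f z.2| / d z.1 z.2)%:E
            | z in [set z : T * T | z.1 <> z.2]].

Definition lip_space : set (T -> R) :=
  [set f | measurable_fun setT f /\ lip_norm f < +oo].

Definition lip_space0 (pi : probability T R) : set (T -> R) :=
  [set f | lip_space f /\ \int[pi]_x (f x)%:E = 0].

Definition eccentricity (pi : probability T R) (p : R) (x : T) : \bar R :=
  \int[pi]_y ((d x y) `^ p)%:E.

End wasserstein.

(* The equation is read in \bar R. As [-oo] is the value of the integral of a
   function whose positive and negative parts both have infinite integral, an
   equality here forces u to be (P x)-integrable for every x, provided that f
   is pi-integrable. *)
Definition poisson_solution (disp : measure_display) (T : measurableType disp)
    (R : realType) (P : R.-pker T ~> T) (pi : probability T R)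
    (f u : T -> R) : Prop :=
  forall x, (u x)%:E - \int[P x]_y (u y)%:E = (f x)%:E - \int[pi]_y (f y)%:E.

(* Main.v *)
Require Import Defs.
From HB Require Import structures.
From mathcomp Require Import all_boot all_order all_algebra.
From mathcomp Require Import all_classical all_reals all_analysis.
From mathcomp Require Import measurable_realfun giry ring lra.

(** The solution is the potential u = sum_n P^n f, and all estimates on it come
    from the easy half of Kantorovich duality: if f is L-Lipschitz and eta
    couples K x and K y, then integrating f z.1 - f z.2 against eta gives
    |K f x - K f y| <= L * \int d deta, hence
    |K f x - K f y| <= tau(K) * L * d x y ([kernel_dual_bound]).  This is
    applied to every iterate K = P^n.

    Integrability is the first issue, since nothing is assumed on the moments
    of P x.  The distance to x0 is pi-integrable; by invariance it is then
    (P x)-integrable for at least one x, and since tau(P) is finite, a coupling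
    of finite cost carries integrability from P x to every other P y
    ([kernel_moment]).  So P acts on Lipschitz functions, and its n-th power
    there is integration against P^n ([markov_iterE]).

    Contraction of P^m makes the Lipschitz constant of P^n f decay like
    M * rho^n with rho < 1 ([markov_iter_geometric]).  A centered Lipschitz
    function is bounded by its Lipschitz constant times the pi-integrable
    function d x0 x + \int d x0 dpi, and centering is preserved by P, so the
    series converges pointwise, dominated by a function that is integrable for
    pi and for every P x.  Dominated convergence gives the mean zero of u
    ([potential_mean]) and lets P act term by term, so that u - P u telescopes
    to f ([potential_poisson]).  The bound of the Lipschitz norm by the sum of
    the tau(P^n) is the triangle inequality applied to the series
    ([potential_dist_le_wasserstein_sum]).  The difference w of two solutions
    satisfies w = P^n w for all n, so its Lipschitz constant vanishes and it is
    a centered constant ([harmonic_lipschitz_eq0]).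

    The moment bound comes from |u x| <= 2 max(|u y|, L * d y x)
    ([lipschitz_moment_le]). *)

Set Implicit Arguments.
Unset Strict Implicit.
Unset Printing Implicit Defensive.
Import Order.TTheory GRing.Theory Num.Theory.
Import numFieldNormedType.Exports.
Local Open Scope classical_set_scope.
Local Open Scope ring_scope.
Local Open Scope ereal_scope.

(** * Integration against mixtures of kernels *)

Section integration.
Context {disp : measure_display} {T : measurableType disp} {R : realType}.

(** The integral of a nonnegative function is a supremum over the simple
    functions below it, so it is monotone on all functions, measurable or not.
    The cost [d] is integrated against couplings this way: only the
    measurability of its sections is established below. *)
Lemma ge0_le_lower_integral (mu : {measure set T -> \bar R})
    (f g : T -> \bar R) :
  (forall x, 0 <= f x) -> (forall x, f x <= g x) ->
  \int[mu]_x f x <= \int[mu]_x g x.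
Proof.
move=> f0 fg; rewrite !ge0_integralTE//; last first.
  by move=> x; exact: le_trans (fg x).
by apply: ereal_sup_le => _ [h hf <-]; exists h => // x; exact: le_trans (fg x).
Qed.

(** [K x] is a measure by coercion; this alias carries the probability
    structure. *)
Definition kernel_at (K : R.-pker T ~> T) (x : T) : set T -> \bar R := K x.

HB.instance Definition _ K x := Measure.on (kernel_at K x).
HB.instance Definition _ K x :=
  Measure_isProbability.Build _ _ _ (kernel_at K x) (prob_kernel x).

(** This covers both the composition of two kernels ([nu] is [K x]) and
    invariance ([mu] and [nu] are both [pi]). A measure satisfying the
    hypothesis agrees on measurable sets with the bind of the Giry monad. *)
Lemma ge0_integral_mixture (K : R.-pker T ~> T) (nu : probability T R)
    (mu : {measure set T -> \bar R}) (g : T -> \bar R) :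
  (forall A, measurable A -> mu A = \int[nu]_x K x A) ->
  measurable_fun setT g -> (forall x, 0 <= g x) ->
  \int[mu]_x g x = \int[nu]_x \int[K x]_y g y.
Proof.
move=> muE mg g0.
have mK : measurable_fun setT (kernel_at K : T -> giry T R).
  by apply: measurable_giry_codensity => // B mB; exact: measurable_kernel.
have := giry_int_bind (nu : giry T R) mK mg g0; rewrite /giry_int => <-.
apply: eq_measure_integral => A mA _; rewrite muE//.
have mA1 : measurable_fun setT (EFin \o \1_A : T -> \bar R).
  exact/measurable_EFinP.
have := giry_int_bind (nu : giry T R) mK mA1.
rewrite /giry_int integral_indic// setIT => -> //.
  by apply: eq_integral => x _; rewrite integral_indic// setIT.
by move=> x; rewrite lee_fin.
Qed.

Lemma integrable_mixture (K : R.-pker T ~> T) (nu : probability T R)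
    (mu : {measure set T -> \bar R}) (g : T -> R) :
  (forall A, measurable A -> mu A = \int[nu]_x K x A) ->
  measurable_fun setT g -> \int[nu]_x \int[K x]_y `|g y|%:E < +oo ->
  mu.-integrable setT (EFin \o g).
Proof.
move=> muE mg foo; apply/integrableP; split; first exact/measurable_EFinP.
under eq_integral do rewrite abse_EFin.
rewrite (ge0_integral_mixture muE)//.
by apply/measurable_EFinP; exact: measurableT_comp.
Qed.

Lemma measurable_Rintegral_kernel (K : R.-pker T ~> T) (g : T -> R) :
  measurable_fun setT g -> measurable_fun setT (fun x => (\int[K x]_y g y)%R).
Proof.
move=> mg; apply: measurableT_comp => //.
under eq_fun do rewrite integralE.
by apply: emeasurable_funB; apply: measurable_fun_integral_kernel => //;
  (try by move=> U; exact: measurable_kernel);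
  [apply: measurable_funepos|apply: measurable_funeneg]; exact/measurable_EFinP.
Qed.

Lemma Rintegral_mixture (K : R.-pker T ~> T) (nu : probability T R)
    (mu : {measure set T -> \bar R}) (g : T -> R) :
  (forall A, measurable A -> mu A = \int[nu]_x K x A) ->
  measurable_fun setT g -> mu.-integrable setT (EFin \o g) ->
  (forall x, (K x).-integrable setT (EFin \o g)) ->
  (\int[mu]_x g x = \int[nu]_x \int[K x]_y g y)%R.
Proof.
move=> muE mg mug Kg.
have mgE : measurable_fun setT (EFin \o g) by exact/measurable_EFinP.
have posE : \int[mu]_x (EFin \o g)^\+ x =
    \int[nu]_x \int[K x]_y (EFin \o g)^\+ y.
  by apply: ge0_integral_mixture => //; exact: measurable_funepos.
have negE : \int[mu]_x (EFin \o g)^\- x =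
    \int[nu]_x \int[K x]_y (EFin \o g)^\- y.
  by apply: ge0_integral_mixture => //; exact: measurable_funeneg.
have ip : nu.-integrable setT (fun x => \int[K x]_y (EFin \o g)^\+ y).
  apply/integrableP; split.
    apply: measurable_fun_integral_kernel => //.
      by move=> U; exact: measurable_kernel.
    exact: measurable_funepos.
  under eq_integral do rewrite gee0_abs ?integral_ge0//.
  rewrite -posE; exact: integral_funepos_lt_pinfty.
have iq : nu.-integrable setT (fun x => \int[K x]_y (EFin \o g)^\- y).
  apply/integrableP; split.
    apply: measurable_fun_integral_kernel => //.
      by move=> U; exact: measurable_kernel.
    exact: measurable_funeneg.
  under eq_integral do rewrite gee0_abs ?integral_ge0//.
  rewrite -negE; exact: integral_funeneg_lt_pinfty.
rewrite /Rintegral; congr fine; rewrite integralE posE negE -integralB//.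
apply: eq_integral => x _; rewrite fineK; last exact: integrable_fin_num.
by rewrite [RHS]integralE.
Qed.

End integration.

(** * Kantorovich duality, easy half *)

Section image_measure.
Context {disp1 disp2 : measure_display} {S : measurableType disp1}
  {T : measurableType disp2} {R : realType}.
Variables (eta : {measure set S -> \bar R}) (mu : {measure set T -> \bar R}).
Variables (phi : S -> T) (mphi : measurable_fun setT phi).
Hypothesis muE : forall A, measurable A -> eta (phi @^-1` A) = mu A.

Lemma ge0_integral_image (g : T -> \bar R) :
  measurable_fun setT g -> (forall x, 0 <= g x) ->
  \int[mu]_x g x = \int[eta]_z g (phi z).
Proof.
move=> mg g0; transitivity (\int[pushforward eta phi]_x g x).
  by apply: eq_measure_integral => A mA _; rewrite -muE.
by rewrite ge0_integral_pushforward// preimage_setT.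
Qed.

Lemma integrable_image (f : T -> R) : measurable_fun setT f ->
  mu.-integrable setT (EFin \o f) <-> eta.-integrable setT (EFin \o (f \o phi)).
Proof.
move=> mf.
have mfphi : measurable_fun setT (f \o phi) by exact: measurableT_comp.
have mfE : measurable_fun setT (EFin \o f) by exact/measurable_EFinP.
have absE : \int[mu]_x `|(EFin \o f) x| =
    \int[eta]_z `|(EFin \o (f \o phi)) z|.
  by rewrite ge0_integral_image//; exact: measurableT_comp.
split=> /integrableP[_ foo]; apply/integrableP; split.
- exact/measurable_EFinP.
- by rewrite -absE.
- by [].
- by rewrite absE.
Qed.

Lemma Rintegral_image (f : T -> R) : measurable_fun setT f ->
  (\int[mu]_x f x = \int[eta]_z f (phi z))%R.
Proof.
move=> mf; have mfE : measurable_fun setT (EFin \o f) by exact/measurable_EFinP.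
rewrite /Rintegral (integralE mu) (integralE eta); congr (fine (_ - _)).
  rewrite ge0_integral_image//; last exact: measurable_funepos.
  by apply: eq_integral => z _; rewrite !funeposE.
rewrite ge0_integral_image//; last exact: measurable_funeneg.
by apply: eq_integral => z _; rewrite !funenegE.
Qed.

End image_measure.

Section wasserstein_duality.
Context {disp : measure_display} {T : measurableType disp} {R : realType}.
Variable d : T -> T -> R.
Hypothesis dM : is_metric d.

(** Measurability is bundled because the operators below preserve both
    properties together. The constant is a real number: [lip_norm] is the least
    one, but the estimates only need some. *)
Definition lipschitz_with (L : R) (f : T -> R) :=
  measurable_fun setT f /\ forall x y, (`|f x - f y| <= L * d x y)%R.

Let d_ge0 x y : (0 <= d x y)%R. Proof. by case: dM. Qed.

Lemma metric_gt0 x y : x <> y -> (0 < d x y)%R.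
Proof.
move=> xy; rewrite lt_neqAle d_ge0 andbT; apply/eqP => /esym d0; apply: xy.
by case: dM => _ d0P _ _; exact/d0P.
Qed.

(** Integrability of [f] for the second marginal is a conclusion: [f z.1] is
    integrable for the coupling and [f z.1 - f z.2] is controlled by the
    cost. *)
Lemma coupling_dual_bound (L : R) (f : T -> R)
    (mu1 mu2 : {measure set T -> \bar R}) (eta : probability (T * T)%type R) :
  (0 <= L)%R -> lipschitz_with L f -> couplings mu1 mu2 eta ->
  \int[eta]_z (d z.1 z.2)%:E < +oo -> mu1.-integrable setT (EFin \o f) ->
  mu2.-integrable setT (EFin \o f) /\
  (`|\int[mu1]_x f x - \int[mu2]_x f x|%R)%:E <=
    L%:E * \int[eta]_z (d z.1 z.2)%:E.
Proof.
move=> L0 [mf Lf] [eta1 eta2] cost_fin if1.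
have muE1 A : measurable A -> eta (fst @^-1` A) = mu1 A.
  by move=> mA; rewrite -eta1// -setXT.
have muE2 A : measurable A -> eta (snd @^-1` A) = mu2 A.
  by move=> mA; rewrite -eta2// -setTX.
have mf1 : measurable_fun setT (f \o fst : T * T -> R).
  exact: measurableT_comp.
have mf2 : measurable_fun setT (f \o snd : T * T -> R).
  exact: measurableT_comp.
have i1 : eta.-integrable setT (EFin \o (f \o fst)).
  by apply/(integrable_image _ muE1).
have mD : measurable_fun setT (fun z : T * T => f z.1 - f z.2)%R.
  exact: measurable_funB.
have bound : \int[eta]_z (`|f z.1 - f z.2|%R)%:E <=
    L%:E * \int[eta]_z (d z.1 z.2)%:E.
  have [L00|Lneq0] := eqVneq L 0%R.
    rewrite L00 mul0e integral0_eq// => z _.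
    by have := Lf z.1 z.2; rewrite L00 mul0r normr_le0 => /eqP ->;
      rewrite normr0.
  have Lgt0 : (0 < L)%R by rewrite lt_neqAle eq_sym Lneq0.
  rewrite -lee_pdivrMl// -ge0_integralZl//; last 2 first.
  - by apply/measurable_EFinP; exact: measurableT_comp.
  - by rewrite lee_fin invr_ge0.
  apply: ge0_le_lower_integral => z.
    by rewrite -EFinM lee_fin mulr_ge0// invr_ge0.
  by rewrite -EFinM lee_fin ler_pdivrMl.
have iD : eta.-integrable setT (EFin \o (fun z : T * T => f z.1 - f z.2)%R).
  apply/integrableP; split; first exact/measurable_EFinP.
  apply: le_lt_trans bound _.
  by apply: lte_mul_pinfty => //; rewrite ?lee_fin.
have i2 : eta.-integrable setT (EFin \o (f \o snd)).
  have := integrableB measurableT i1 iD; apply: eq_integrable => // z _ /=.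
  by rewrite -EFinB; congr EFin; lra.
split; first by apply/(integrable_image _ muE2).
rewrite (Rintegral_image _ muE1)// (Rintegral_image _ muE2)//.
rewrite -RintegralB//.
apply: le_trans bound.
apply: (@le_trans _ _ (\int[eta]_z `|f z.1 - f z.2|)%R%:E).
  by rewrite lee_fin; exact: le_normr_Rintegral.
rewrite fineK//; apply: integrable_fin_num => //.
exact: integrable_norm iD.
Qed.

Lemma wasserstein_ge0 (mu1 mu2 : {measure set T -> \bar R}) :
  0 <= wasserstein d mu1 mu2.
Proof.
apply/ereal_infP => _ [eta _ <-].
by apply: integral_ge0 => z _; rewrite lee_fin.
Qed.

Lemma wasserstein_coef_ge0 (K : R.-pker T ~> T) :
  (exists x y : T, x <> y) -> 0 <= wasserstein_coef d K.
Proof.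
move=> [x [y xy]].
apply: le_trans (ereal_sup_ubound (ex_intro2 _ _ (x, y) xy erefl)) => /=.
have dxy := metric_gt0 xy.
by rewrite inver gt_eqF// mule_ge0 ?wasserstein_ge0// lee_fin invr_ge0.
Qed.

Lemma wasserstein_le_coef (K : R.-pker T ~> T) x y : x <> y ->
  wasserstein d (K x) (K y) <= wasserstein_coef d K * (d x y)%:E.
Proof.
move=> xy; have dxy := metric_gt0 xy; rewrite -lee_pdivrMr//.
have := ereal_sup_ubound (ex_intro2 _ _ (x, y) xy erefl :
  [set wasserstein d (K z.1) (K z.2) / (d z.1 z.2)%:E
    | z in [set z : T * T | z.1 <> z.2]] _).
by rewrite /= inver gt_eqF.
Qed.

(** Finiteness of tau provides a coupling of finite cost between any two of the
    measures of the kernel. *)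
Lemma kernel_integrable_transfer (K : R.-pker T ~> T) (L : R) f x :
  (0 <= L)%R -> wasserstein_coef d K < +oo -> lipschitz_with L f ->
  (K x).-integrable setT (EFin \o f) ->
  forall y, (K y).-integrable setT (EFin \o f).
Proof.
move=> L0 Koo Lf ix y; have [->//|/eqP xy] := eqVneq y x.
have Woo : wasserstein d (K x) (K y) < +oo.
  apply: le_lt_trans (wasserstein_le_coef K _) _; first exact/nesym.
  have neT : exists x y : T, x <> y by exists y, x.
  have [t t0 ->] : exists2 t : R, (0 <= t)%R & wasserstein_coef d K = t%:E.
    exists (fine (wasserstein_coef d K)).
      by rewrite fine_ge0// wasserstein_coef_ge0.
    by rewrite fineK// ge0_fin_numE// wasserstein_coef_ge0.
  by rewrite -EFinM ltry.
have [_ [eta ceta <-] etaoo] := ereal_inf_lt Woo.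
by have [] := coupling_dual_bound L0 Lf ceta etaoo ix.
Qed.

Lemma kernel_dual_bound (K : R.-pker T ~> T) (L : R) f :
  (0 <= L)%R -> lipschitz_with L f ->
  (forall x, (K x).-integrable setT (EFin \o f)) -> forall x y,
  (`|\int[K x]_z f z - \int[K y]_z f z|%R)%:E <=
    wasserstein_coef d K * (L * d x y)%:E.
Proof.
move=> L0 Lf Kf x y; have [->|/eqP xy] := eqVneq x y.
  by case: dM => _ d0P _ _; rewrite subrr normr0 (d0P y y).2// mulr0 mule0.
(* Here tau may be infinite and the right-hand side 0, but [f] is constant. *)
have [L00|Lneq0] := eqVneq L 0%R.
  have fE : f = cst (f x).
    apply/funext => z /=; apply/eqP; rewrite -subr_eq0 -normr_le0.
    by have := Lf.2 z x; rewrite L00 mul0r.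
  by rewrite fE !Rintegral_cst// !prob_kernel subrr normr0 L00 mul0r mule0.
have Lgt0 : (0 < L)%R by rewrite lt_neqAle eq_sym Lneq0.
apply: (@le_trans _ _ (L%:E * wasserstein d (K x) (K y))).
  rewrite -lee_pdivrMl//; apply/ereal_infP => _ [eta ceta <-].
  rewrite lee_pdivrMl//.
  have [->|etaoo] := eqVneq (\int[eta]_z (d z.1 z.2)%:E) +oo.
    by rewrite gt0_muley ?lte_fin// leey.
  have {}etaoo : \int[eta]_z (d z.1 z.2)%:E < +oo by rewrite ltey.
  by have [] := coupling_dual_bound L0 Lf ceta etaoo (Kf x).
rewrite EFinM muleCA; apply: lee_wpmul2l; first by rewrite lee_fin.
exact: wasserstein_le_coef.
Qed.

End wasserstein_duality.

(** * The Markov operator on Lipschitz functions *)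

Section markov_operator.
Context {disp : measure_display} {T : measurableType disp} {R : realType}.
Variable d : T -> T -> R.
Hypothesis dM : is_metric d.

Definition markov_op (K : R.-pker T ~> T) (f : T -> R) (x : T) : R :=
  (\int[K x]_y f y)%R.

Let d_ge0 x y : (0 <= d x y)%R. Proof. by case: dM. Qed.

Lemma lipschitz_with_le (L L' : R) f :
  (L <= L')%R -> lipschitz_with d L f -> lipschitz_with d L' f.
Proof.
move=> LL' [mf Lf]; split=> // x y; apply: le_trans (Lf x y) _.
exact: ler_wpM2r.
Qed.

Lemma lipschitz_with_norm (L : R) f :
  lipschitz_with d L f -> lipschitz_with d L (fun x => `|f x|)%R.
Proof.
move=> [mf Lf]; split=> [|x y]; first exact: measurableT_comp.
exact: le_trans (ler_dist_dist _ _) (Lf x y).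
Qed.

Lemma lipschitz_with_dist x :
  measurable_fun setT (d x) -> lipschitz_with d 1 (d x).
Proof.
move=> mdx; split=> // y z; rewrite mul1r.
case: dM => _ _ dC dtri; rewrite ler_norml; apply/andP; split.
  by have := dtri x y z; lra.
by have := dtri x z y; rewrite (dC z y); lra.
Qed.

(** [f] grows at most linearly in the distance to [x0]. *)
Lemma lipschitz_integrable (mu : probability T R) x0 (L : R) f :
  mu.-integrable setT (EFin \o d x0) -> lipschitz_with d L f ->
  mu.-integrable setT (EFin \o f).
Proof.
move=> id [mf Lf].
have iL : mu.-integrable setT (EFin \o (fun x => `|f x0| + L * d x0 x)%R).
  have := integrableD measurableT
    (finite_measure_integrable_cst mu `|f x0|%R measurableT)
    (integrableZl measurableT L id).
  by apply: eq_integrable => // x _ /=; rewrite EFinD EFinM.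
apply: le_integrable iL => //; first exact/measurable_EFinP.
move=> x _ /=; rewrite lee_fin; apply: le_trans (ler_norm _).
have := Lf x0 x; rewrite distrC => h.
have -> : f x = (f x0 + (f x - f x0))%R by lra.
by apply: le_trans (ler_normD _ _) _; rewrite lerD2l.
Qed.

Lemma markov_op_lipschitz (K : R.-pker T ~> T) (L t : R) f :
  (0 <= L)%R -> wasserstein_coef d K <= t%:E -> lipschitz_with d L f ->
  (forall x, (K x).-integrable setT (EFin \o f)) ->
  lipschitz_with d (t * L) (markov_op K f).
Proof.
move=> L0 Kt Lf Kf; split; first exact/measurable_Rintegral_kernel/Lf.1.
move=> x y; rewrite -lee_fin.
apply: le_trans (kernel_dual_bound dM L0 Lf Kf x y) _.
rewrite -mulrA [leRHS]EFinM; apply: lee_wpmul2r => //.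
by rewrite lee_fin mulr_ge0.
Qed.

Variable P : R.-pker T ~> T.
Variable x0 : T.
Hypothesis T_nontrivial : exists x y : T, x <> y.
Hypothesis P_fin : wasserstein_coef d P < +oo.
Hypothesis P_moment : forall x, (P x).-integrable setT (EFin \o d x0).

Lemma lipschitz_integrable_kernel (L : R) f x : lipschitz_with d L f ->
  (P x).-integrable setT (EFin \o f).
Proof. exact: (@lipschitz_integrable (kernel_at P x) x0 L f (P_moment x)). Qed.

Lemma wasserstein_coef_fin (K : R.-pker T ~> T) : wasserstein_coef d K < +oo ->
  exists2 t : R, (0 <= t)%R & wasserstein_coef d K = t%:E.
Proof.
move=> Koo; have K0 := wasserstein_coef_ge0 dM K T_nontrivial.
exists (fine (wasserstein_coef d K)); first by rewrite fine_ge0.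
by rewrite fineK// ge0_fin_numE.
Qed.

(** The base [t] is the maximum of tau(P) and 1, so that the powers are
    monotone in the exponent; [markov_iter_geometric] uses this to bound the
    remainder of the division of the exponent by m. *)
Lemma markov_iter_lipschitz_pow : exists2 t : R, (1 <= t)%R &
  forall n (L : R) f, (0 <= L)%R -> lipschitz_with d L f ->
    lipschitz_with d (t ^+ n * L) (iter n (markov_op P) f).
Proof.
have [t t0 Pt] := wasserstein_coef_fin P_fin.
exists (Num.max t 1%R); first by rewrite le_max lexx orbT.
have t1 : (0 <= Num.max t 1%R)%R by rewrite le_max t0.
move=> n L f L0 Lf; elim: n => [|n IHn] /=; first by rewrite expr0 mul1r.
rewrite exprS -mulrA; apply: markov_op_lipschitz => //.
- by rewrite mulr_ge0// exprn_ge0.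
- by rewrite Pt lee_fin le_max lexx.
- by move=> x; exact: lipschitz_integrable_kernel IHn.
Qed.

(** The step applies the induction hypothesis also to [|f|], which is again
    Lipschitz: its integral against P^n is then a Lipschitz function, hence
    (P x)-integrable. *)
Lemma markov_iterE n (L : R) f : (0 <= L)%R -> lipschitz_with d L f ->
  (forall x, (kernel_iter P n x).-integrable setT (EFin \o f)) /\
  markov_op (kernel_iter P n) f = iter n (markov_op P) f.
Proof.
have [t t1 Lpow] := markov_iter_lipschitz_pow.
elim: n L f => [|n IHn] L f L0 Lf.
  have mf := Lf.1.
  have mfE : measurable_fun setT (EFin \o f) by exact/measurable_EFinP.
  split=> [x|].
    apply/integrableP; split=> //=.
    rewrite integral_dirac ?diracT ?mul1e ?ltry//.
    by apply/measurable_EFinP; exact: measurableT_comp.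
  apply/funext => x; rewrite /markov_op /Rintegral /= integral_dirac//.
  by rewrite diracT mul1e.
have [nf nfE] := IHn L f L0 Lf.
have [nabsf nabsfE] := IHn L _ L0 (lipschitz_with_norm Lf).
have mixE x A : measurable A ->
    kernel_iter P n.+1 x A = \int[kernel_at P x]_y kernel_iter P n y A.
  by [].
have nSf x : (kernel_iter P n.+1 x).-integrable setT (EFin \o f).
  apply: (integrable_mixture (mixE x)); first exact: Lf.1.
  have := lipschitz_integrable_kernel x
    (Lpow n L _ L0 (lipschitz_with_norm Lf)).
  move=> /(integrable_fin_num measurableT); rewrite ltey -nabsfE.
  rewrite (@eq_integral _ _ _ _ _
    (fun y => \int[kernel_iter P n y]_z `|f z|%:E)); first by case: integral.
  move=> y _ /=; rewrite /markov_op fineK//.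
  exact: integrable_fin_num (nabsf y).
split=> //; rewrite iterS -nfE; apply/funext => x.
exact: (Rintegral_mixture (mixE x) Lf.1).
Qed.

Lemma markov_iter_dual_bound n (L : R) f x y :
  (0 <= L)%R -> lipschitz_with d L f ->
  (`|iter n (markov_op P) f x - iter n (markov_op P) f y|%R)%:E <=
    wasserstein_coef d (kernel_iter P n) * (L * d x y)%:E.
Proof.
move=> L0 Lf; have [nf <-] := markov_iterE n L0 Lf.
exact: kernel_dual_bound.
Qed.

(** Write n = r + k m with r < m. The k blocks of length m contribute theta^k,
    the remaining r steps at most t^m. With rho the m-th root of theta this is
    at most (t / rho)^m * rho^n. *)
Lemma markov_iter_geometric m : (1 <= m)%N ->
  wasserstein_coef d (kernel_iter P m) < 1 ->
  exists M rho : R, [/\ (0 <= M)%R, (0 < rho < 1)%R &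
    forall n (L : R) f, (0 <= L)%R -> lipschitz_with d L f ->
      lipschitz_with d (M * rho ^+ n * L) (iter n (markov_op P) f)].
Proof.
move=> m1 Pm1.
have [t t1 Lpow] := markov_iter_lipschitz_pow.
have t0 : (0 <= t)%R := le_trans ler01 t1.
have [s s0 Ps] := wasserstein_coef_fin (lt_trans Pm1 (ltry 1)).
have {}s1 : (s < 1)%R by rewrite -lte_fin -Ps.
(* [theta] has to be positive for [rho] to be invertible. *)
pose theta : R := Num.max s 2^-1%R.
have th0 : (0 < theta)%R by rewrite lt_max invr_gt0 ltr0n orbT.
have th1 : (theta < 1)%R by rewrite gt_max s1 invf_lt1// ltr1n.
pose rho : R := (theta `^ (m%:R^-1))%R.
have m0 : (m%:R != 0 :> R)%R by rewrite pnatr_eq0 -lt0n.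
have rhom : (rho ^+ m = theta)%R.
  by rewrite -powR_mulrn ?powR_ge0// -powRrM mulVf// powRr1// ltW.
have rho0 : (0 < rho)%R by rewrite powR_gt0.
have rho1 : (rho < 1)%R.
  rewrite ltNge; apply/negP => h; have := exprn_ege1 m h.
  by rewrite rhom leNgt th1.
have Lmul k (L : R) f : (0 <= L)%R -> lipschitz_with d L f ->
    lipschitz_with d (theta ^+ k * L) (iter (k * m) (markov_op P) f).
  move=> L0 Lf; elim: k => [|k IHk]; first by rewrite mul0n expr0 mul1r.
  have kL0 : (0 <= theta ^+ k * L)%R by rewrite mulr_ge0// exprn_ge0// ltW.
  rewrite mulSn iterD; have [mf <-] := markov_iterE m kL0 IHk.
  rewrite exprS -mulrA; apply: markov_op_lipschitz => //.
  by rewrite Ps lee_fin le_max lexx.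
exists (t ^+ m / rho ^+ m)%R, rho; split.
- by rewrite divr_ge0// exprn_ge0// ltW.
- by rewrite rho0.
move=> n L f L0 Lf.
rewrite [in iter n](divn_eq n m) addnC iterD.
have kL0 : (0 <= theta ^+ (n %/ m) * L)%R by rewrite mulr_ge0// exprn_ge0// ltW.
apply: lipschitz_with_le (Lpow _ _ _ kL0 (Lmul _ _ _ L0 Lf)).
rewrite mulrA; apply: ler_wpM2r => //.
have -> : (rho ^+ n = rho ^+ (n %% m) * theta ^+ (n %/ m))%R.
  by rewrite [in LHS](divn_eq n m) addnC exprD mulnC exprM rhom.
rewrite mulrA; apply: ler_wpM2r; first by rewrite exprn_ge0// ltW.
have nm : (n %% m <= m)%N by rewrite ltnW// ltn_mod.
rewrite -mulrA; apply: (@le_trans _ _ (t ^+ m)%R).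
  exact: ler_weXn2l.
rewrite ler_peMr//; first by rewrite exprn_ge0.
rewrite mulrC ler_pdivlMr ?exprn_gt0// mul1r.
by rewrite ler_wiXn2l// ltW.
Qed.

End markov_operator.

(** * The potential of a centered Lipschitz function *)

Section resolvent_series.
Context {disp : measure_display} {T : measurableType disp} {R : realType}.
Variable d : T -> T -> R.
Hypothesis dM : is_metric d.
Variables (P : R.-pker T ~> T) (pi : probability T R) (x0 : T).
Hypothesis md : measurable_fun setT (d x0).
Hypothesis T_nontrivial : exists x y : T, x <> y.
Hypothesis P_fin : wasserstein_coef d P < +oo.
Hypothesis piP : invariant_distribution P pi.
Hypothesis pi_moment : pi.-integrable setT (EFin \o d x0).

Let d_ge0 x y : (0 <= d x y)%R. Proof. by case: dM. Qed.

(** By invariance the (P z)-integral of the distance has a finite pi-mean, so it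
    is finite at some [z]; [kernel_integrable_transfer] does the rest. *)
Lemma kernel_moment x : (P x).-integrable setT (EFin \o d x0).
Proof.
suff [z zoo] : exists z, \int[P z]_y (d x0 y)%:E < +oo.
  apply: (kernel_integrable_transfer dM (x := z) ler01 P_fin) => //.
    exact: lipschitz_with_dist.
  apply/integrableP; split; first exact/measurable_EFinP.
  by under eq_integral do rewrite gee0_abs ?lee_fin//.
apply: contrapT => /forallNP Poo.
have := integrable_fin_num measurableT pi_moment.
rewrite (@ge0_integral_mixture _ _ _ P pi pi (EFin \o d x0))//; last 3 first.
- by move=> A mA; rewrite piP.
- exact/measurable_EFinP.
- by move=> y; rewrite lee_fin.
suff -> : \int[pi]_z \int[P z]_y (d x0 y)%:E = +oo by [].
transitivity (\int[pi]_z (cst +oo z : \bar R)).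
  apply: eq_integral => z _ /=; apply/eqP; rewrite -leye_eq leNgt.
  exact/negP/Poo.
by rewrite integral_cst//= probability_setT mule1.
Qed.

Lemma markov_op_mean (L : R) f : lipschitz_with d L f ->
  (\int[pi]_x markov_op P f x = \int[pi]_x f x)%R.
Proof.
move=> Lf; apply/esym.
apply: (@Rintegral_mixture _ _ _ P pi pi) => //.
- by move=> A mA; rewrite piP.
- exact: Lf.1.
- exact: (lipschitz_integrable pi_moment Lf).
- by move=> x; exact: (lipschitz_integrable_kernel kernel_moment x Lf).
Qed.

(** The common envelope of the centered 1-Lipschitz functions, see
    [centered_lipschitz_bound]; it dominates the series of the potential. *)
Definition dominating (x : T) : R := (d x0 x + \int[pi]_y d x0 y)%R.

Lemma dominating_ge0 x : (0 <= dominating x)%R.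
Proof. by rewrite addr_ge0// Rintegral_ge0. Qed.

Lemma dominating_integrable (mu : probability T R) :
  mu.-integrable setT (EFin \o d x0) ->
  mu.-integrable setT (EFin \o dominating).
Proof.
move=> id; have := integrableD measurableT id
  (finite_measure_integrable_cst mu (\int[pi]_y d x0 y)%R measurableT).
by apply: eq_integrable => // x _ /=; rewrite EFinD.
Qed.

(** At [x0], centering gives f x0 = \int (f x0 - f y) pi(dy). *)
Lemma centered_lipschitz_bound (L : R) f x : (0 <= L)%R ->
  lipschitz_with d L f -> (\int[pi]_y f y)%R = 0%R ->
  (`|f x| <= L * dominating x)%R.
Proof.
move=> L0 Lf f0.
have iF := lipschitz_integrable pi_moment Lf.
have ic := finite_measure_integrable_cst pi (f x0) measurableT.
have fx0 : (`|f x0| <= L * \int[pi]_y d x0 y)%R.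
  have -> : f x0 = (\int[pi]_y (f x0 - f y))%R.
    rewrite (RintegralB measurableT ic iF) f0 subr0.
    by rewrite Rintegral_cst//= probability_setT mulr1.
  have iB : pi.-integrable setT (EFin \o (fun y => f x0 - f y)%R).
    have := integrableB measurableT ic iF.
    by apply: eq_integrable => // y _ /=; rewrite EFinB.
  apply: le_trans (le_normr_Rintegral measurableT iB) _.
  rewrite -RintegralZl//; apply: le_Rintegral => //.
  - exact: integrable_norm iB.
  - have := integrableZl measurableT L pi_moment.
    by apply: eq_integrable => // y _ /=; rewrite EFinM.
  - by move=> y _; exact: Lf.2.
have -> : f x = (f x0 + (f x - f x0))%R by lra.
apply: le_trans (ler_normD _ _) _; rewrite /dominating mulrDr addrC.
by apply: lerD => //; rewrite distrC; exact: Lf.2.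
Qed.

Variables M rho : R.
Hypotheses (M0 : (0 <= M)%R) (rho01 : (0 < rho < 1)%R).
Hypothesis geo : forall n (L : R) f, (0 <= L)%R -> lipschitz_with d L f ->
  lipschitz_with d (M * rho ^+ n * L) (iter n (markov_op P) f).

Let rho_ge0 : (0 <= rho)%R. Proof. by rewrite ltW//; case/andP: rho01. Qed.

Let rho_lt1 : (`|rho| < 1)%R.
Proof. by rewrite ger0_norm//; case/andP: rho01. Qed.

Lemma sum_geometric_le (a : R) n : (0 <= a)%R ->
  (\sum_(k < n) a * rho ^+ k <= a / (1 - rho))%R.
Proof.
move=> a0; rewrite -(cvg_lim _ (@cvg_geometric_series R a _ rho_lt1))//.
have -> : (\sum_(k < n) a * rho ^+ k)%R = series (geometric a rho) n.
  by rewrite /series /= big_mkord.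
apply: nondecreasing_cvgn_le; last exact: is_cvg_geometric_series.
apply/nondecreasing_seqP => k; rewrite /series /= big_nat_recr//= lerDl.
by rewrite mulr_ge0// exprn_ge0.
Qed.

Definition potential_sum (f : T -> R) (n : nat) (x : T) : R :=
  (\sum_(k < n) iter k (markov_op P) f x)%R.

Lemma potential_sum0 f : potential_sum f 0 = cst 0%R.
Proof. by apply/funext => y; rewrite /potential_sum big_ord0. Qed.

Lemma potential_sumS f n : potential_sum f n.+1 =
  (fun y => potential_sum f n y + iter n (markov_op P) f y)%R.
Proof. by apply/funext => y; rewrite /potential_sum big_ord_recr. Qed.

Lemma potential_sum_series f x : (fun n => potential_sum f n x) =
  series (fun k => iter k (markov_op P) f x).
Proof.
by apply/funext => n; rewrite /series /potential_sum /= big_mkord.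
Qed.

(** The resolvent (1 - P)^-1 applied to [f], as a Neumann series; [limn] is
    meaningful by [cvg_potential]. *)
Definition potential (f : T -> R) (x : T) : R :=
  limn (fun n => potential_sum f n x).

Section fixed_forcing.
Variables (L : R) (f : T -> R).
Hypotheses (L0 : (0 <= L)%R) (Lf : lipschitz_with d L f).

Let C : R := (M * L / (1 - rho))%R.

Let C_ge0 : (0 <= C)%R.
Proof.
by rewrite divr_ge0 ?mulr_ge0// subr_ge0 ltW//; case/andP: rho01.
Qed.

Let coef_ge0 n : (0 <= M * rho ^+ n * L)%R.
Proof. by rewrite !mulr_ge0// exprn_ge0. Qed.

Lemma measurable_potential_sum n : measurable_fun setT (potential_sum f n).
Proof. by apply: measurable_sum => k; have [] := geo k L0 Lf. Qed.

Lemma potential_sum_lipschitz n : lipschitz_with d C (potential_sum f n).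
Proof.
split=> [|x y]; first exact: measurable_potential_sum.
rewrite /potential_sum -sumrB.
apply: le_trans (ler_norm_sum _ _ _) _.
apply: (@le_trans _ _ (\sum_(k < n) M * L * rho ^+ k * d x y)%R).
  apply: ler_sum => k _; have [_ /(_ x y)] := geo k L0 Lf.
  by rewrite (mulrAC M).
rewrite -mulr_suml; apply: ler_wpM2r => //.
by apply: sum_geometric_le; rewrite mulr_ge0.
Qed.

Lemma markov_op_potential_sum n x :
  markov_op P (potential_sum f n) x = (potential_sum f n.+1 x - f x)%R.
Proof.
elim: n => [|n IHn].
  rewrite potential_sumS potential_sum0 /markov_op Rintegral_cst//.
  by rewrite mul0r /= add0r subrr.
rewrite [in LHS]potential_sumS /markov_op RintegralD//.
- rewrite -[X in (X + _)%R]/(markov_op P (potential_sum f n) x) IHn.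
  by rewrite [in RHS]potential_sumS addrAC.
- exact: (lipschitz_integrable_kernel kernel_moment _
    (potential_sum_lipschitz n)).
- exact: (lipschitz_integrable_kernel kernel_moment _ (geo n L0 Lf)).
Qed.

Hypothesis f0 : (\int[pi]_y f y)%R = 0%R.

Lemma markov_iter_mean n : (\int[pi]_y iter n (markov_op P) f y)%R = 0%R.
Proof.
by elim: n => [//|n IHn]; rewrite iterS (markov_op_mean (geo n L0 Lf)).
Qed.

Let term_bound n x :
  (`|iter n (markov_op P) f x| <= M * L * dominating x * rho ^+ n)%R.
Proof.
have := centered_lipschitz_bound x (coef_ge0 n) (geo n L0 Lf)
  (markov_iter_mean n).
by move=> /le_trans; apply; rewrite le_eqVlt; apply/orP; left; apply/eqP; ring.
Qed.

Let MLG_ge0 x : (0 <= M * L * dominating x)%R.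
Proof. by rewrite !mulr_ge0// dominating_ge0. Qed.

Lemma potential_sum_bound n x :
  (`|potential_sum f n x| <= C * dominating x)%R.
Proof.
rewrite /potential_sum; apply: le_trans (ler_norm_sum _ _ _) _.
apply: (@le_trans _ _ (\sum_(k < n) M * L * dominating x * rho ^+ k)%R).
  by apply: ler_sum => k _; exact: term_bound.
by rewrite /C [leRHS]mulrAC; apply: sum_geometric_le.
Qed.

Lemma cvg_potential x : potential_sum f n x @[n --> \oo] --> potential f x.
Proof.
rewrite /potential potential_sum_series.
apply: normed_cvg; apply: (series_le_cvg _ _ (term_bound ^~ x)).
- by move=> n /=.
- by move=> n; rewrite mulr_ge0// exprn_ge0.
- exact: is_cvg_geometric_series.
Qed.

Lemma potential_dist_le (r : R) x y :
  (forall n, `|potential_sum f n x - potential_sum f n y| <= r)%R ->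
  (`|potential f x - potential f y| <= r)%R.
Proof.
move=> h; have cv :
    `|potential_sum f n x - potential_sum f n y|%R @[n --> \oo] -->
    `|potential f x - potential f y|%R.
  by apply: cvg_norm; apply: cvgB; exact: cvg_potential.
rewrite -(cvg_lim _ cv)//; apply: limr_le.
  by apply/cvg_ex; eexists; exact: cv.
exact: nearW.
Qed.

Lemma potential_lipschitz : lipschitz_with d C (potential f).
Proof.
split=> [|x y].
  apply: (measurable_fun_cvg (h := potential_sum f)) => [n|x _].
    exact: measurable_potential_sum.
  exact: cvg_potential.
by apply: potential_dist_le => n; have [_] := potential_sum_lipschitz n.
Qed.

Lemma cvg_Rintegral_potential (mu : probability T R) :
  mu.-integrable setT (EFin \o d x0) ->
  (\int[mu]_x potential_sum f n x)%R @[n --> \oo] -->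
    (\int[mu]_x potential f x)%R.
Proof.
move=> id.
have iG : mu.-integrable setT (EFin \o (fun x => C * dominating x)%R).
  have := integrableZl measurableT C (dominating_integrable id).
  by apply: eq_integrable => // x _ /=; rewrite EFinM.
have [|||||iu _ cvI] := @dominated_convergence _ _ _ mu setT measurableT
  (fun n x => (potential_sum f n x)%:E) (fun x => (potential f x)%:E)
  (EFin \o (fun x => C * dominating x)%R).
- by move=> n; apply/measurable_EFinP; exact: measurable_potential_sum.
- by apply/measurable_EFinP; exact: potential_lipschitz.1.
- by apply: aeW => x _; apply: cvg_EFin; [exact: nearW|exact: cvg_potential].
- exact: iG.
- by apply: aeW => x n _; rewrite lee_fin; exact: potential_sum_bound.
apply: fine_cvg; rewrite fineK//; exact: integrable_fin_num.
Qed.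

Lemma potential_mean : (\int[pi]_x potential f x)%R = 0%R.
Proof.
apply: cvg_unique (cvg_Rintegral_potential pi_moment) _ => //.
rewrite (_ : (fun n => _) = cst 0%R); first exact: cvg_cst.
apply/funext => n; elim: n => [|n IHn].
  by rewrite potential_sum0 Rintegral_cst// mul0r.
rewrite /= potential_sumS RintegralD//.
- by rewrite IHn markov_iter_mean addr0.
- exact: (lipschitz_integrable pi_moment (potential_sum_lipschitz n)).
- exact: (lipschitz_integrable pi_moment (geo n L0 Lf)).
Qed.

Lemma potential_poisson x :
  markov_op P (potential f) x = (potential f x - f x)%R.
Proof.
apply: cvg_unique
  (cvg_Rintegral_potential (mu := kernel_at P x) (kernel_moment x)) _ => //.
rewrite (_ : (fun n => _) =
  (fun n => potential_sum f n.+1 x - f x)%R); last first.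
  by apply/funext => n; rewrite -markov_op_potential_sum.
apply: cvgB; last exact: cvg_cst.
by rewrite (cvg_shiftS (fun n => potential_sum f n x)); exact: cvg_potential.
Qed.

(** Stated in the extended reals, so that it also makes sense before the sum of
    the tau(P^n) is known to be finite. *)
Lemma potential_dist_le_wasserstein_sum x y :
  (`|potential f x - potential f y|%R)%:E <=
    wasserstein_sum d P * (L * d x y)%:E.
Proof.
have tau_ge0 n : 0 <= wasserstein_coef d (kernel_iter P n).
  exact: wasserstein_coef_ge0.
have Ld_ge0 : (0 <= L * d x y)%R by rewrite mulr_ge0.
have sumE : wasserstein_sum d P * (L * d x y)%:E =
    \sum_(0 <= n <oo) (L * d x y)%:E * wasserstein_coef d (kernel_iter P n).
  by rewrite muleC nneseriesZl.
have partial n : (`|potential_sum f n x - potential_sum f n y|%R)%:E <=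
    wasserstein_sum d P * (L * d x y)%:E.
  rewrite sumE.
  apply: le_trans (nneseries_lim_ge n _); last first.
    by move=> k _ _; rewrite mule_ge0// lee_fin.
  rewrite big_mkord /potential_sum -sumrB.
  apply: (@le_trans _ _ (\sum_(k < n) `|iter k (markov_op P) f x -
      iter k (markov_op P) f y|)%R%:E).
    by rewrite lee_fin; exact: ler_norm_sum.
  rewrite -sumEFin; apply: lee_sum => k _; rewrite muleC.
  exact: (markov_iter_dual_bound dM T_nontrivial P_fin kernel_moment k
    x y L0 Lf).
move: partial.
have [->|roo] := eqVneq (wasserstein_sum d P * (L * d x y)%:E) +oo.
  by rewrite leey.
have /fineK <- : wasserstein_sum d P * (L * d x y)%:E \is a fin_num.
  by rewrite ge0_fin_numE ?ltey// mule_ge0// ?lee_fin// nneseries_ge0.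
move=> partial; rewrite lee_fin; apply: potential_dist_le => n.
by rewrite -lee_fin.
Qed.

End fixed_forcing.

(** [w] is Lipschitz with every constant M rho^n L, so it is constant. *)
Lemma harmonic_lipschitz_eq0 (L : R) w : (0 <= L)%R -> lipschitz_with d L w ->
  (\int[pi]_y w y)%R = 0%R -> markov_op P w = w -> w = cst 0%R.
Proof.
move=> L0 Lw w0 Pw.
have itw n : iter n (markov_op P) w = w by elim: n => //= n ->.
have cv x y : (M * L * d x y * rho ^+ n)%R @[n --> \oo] --> (0 : R)%R.
  exact: cvg_geometric.
have Lw0 : lipschitz_with d 0 w.
  split=> [|x y]; first exact: Lw.1.
  rewrite mul0r -(cvg_lim _ (cv x y))//; apply: limr_ge.
    by apply/cvg_ex; eexists; exact: cv.
  apply: nearW => n; have [_ /(_ x y)] := geo n L0 Lw; rewrite itw.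
  move=> /le_trans; apply; rewrite le_eqVlt; apply/orP; left.
  by apply/eqP; ring.
apply/funext => x; apply/eqP; rewrite -normr_le0.
by rewrite -(mul0r (dominating x)) centered_lipschitz_bound.
Qed.

End resolvent_series.

(** * Lipschitz norm, eccentricity and sections of the metric *)

Section lipschitz_norm.
Context {disp : measure_display} {T : measurableType disp} {R : realType}.
Variable d : T -> T -> R.
Hypothesis dM : is_metric d.
Hypothesis T_nontrivial : exists x y : T, x <> y.

Let d_ge0 x y : (0 <= d x y)%R. Proof. by case: dM. Qed.

Lemma lip_norm_ge0 (f : T -> R) : 0 <= lip_norm d f.
Proof.
have [x [y xy]] := T_nontrivial.
apply: le_trans (ereal_sup_ubound (ex_intro2 _ _ (x, y) xy erefl)) => /=.
by rewrite lee_fin divr_ge0.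
Qed.

Lemma lip_norm_le (f : T -> R) (L : \bar R) :
  (forall x y, (`|f x - f y|%R)%:E <= L * (d x y)%:E) -> lip_norm d f <= L.
Proof.
move=> Lf; apply: ge_ereal_sup => _ [[x y] /= xy <-].
by rewrite EFinM lee_pdivrMr//; exact: metric_gt0.
Qed.

Lemma lip_spaceP (f : T -> R) : lip_space d f ->
  [/\ (0 <= fine (lip_norm d f))%R, lip_norm d f = (fine (lip_norm d f))%:E &
      lipschitz_with d (fine (lip_norm d f)) f].
Proof.
move=> [mf foo].
have fE : lip_norm d f = (fine (lip_norm d f))%:E.
  by rewrite fineK// ge0_fin_numE// lip_norm_ge0.
split=> //; first by rewrite fine_ge0// lip_norm_ge0.
split=> // x y; have [->|/eqP xy] := eqVneq x y.
  by case: dM => _ d0P _ _; rewrite subrr normr0 (d0P y y).2// mulr0.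
rewrite -ler_pdivrMr; last exact: metric_gt0.
by rewrite -lee_fin -fE; apply: ereal_sup_ubound; exists (x, y).
Qed.

Lemma lipschitz_with_lip_space (L : R) (f : T -> R) :
  lipschitz_with d L f -> lip_space d f.
Proof.
move=> [mf Lf]; split=> //; apply: (@le_lt_trans _ _ L%:E); last exact: ltry.
by apply: lip_norm_le => x y; rewrite -EFinM lee_fin.
Qed.

(** |u x| <= |u y| + L d y x <= 2 max(|u y|, L d y x), and the p-th power of the
    maximum is at most the sum of the p-th powers. *)
Lemma lipschitz_moment_le (pi : probability T R) (p L : R) (u : T -> R) y :
  (1 <= p)%R -> (0 <= L)%R -> lipschitz_with d L u ->
  measurable_fun setT (d y) ->
  \int[pi]_x (`|u x| `^ p)%:E <=
    (2 `^ p)%:E * ((`|u y| `^ p)%:E + (L `^ p)%:E * eccentricity d pi p y).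
Proof.
move=> p1 L0 [mu Lu] mdy.
have p0 : (0 <= p)%R := le_trans ler01 p1.
have mdp : measurable_fun setT (fun x => (d y x `^ p)%:E).
  by apply/measurable_EFinP; exact: (measurableT_comp (measurable_powR p)).
rewrite /eccentricity -ge0_integralZl//; last 2 first.
- by move=> x _; rewrite lee_fin powR_ge0.
- by rewrite lee_fin powR_ge0.
have -> : (`|u y| `^ p)%:E = \int[pi]_x (`|u y| `^ p)%:E.
  by rewrite integral_cst//= probability_setT mule1.
rewrite -ge0_integralD//; last 2 first.
- by move=> x _; rewrite -EFinM lee_fin mulr_ge0// powR_ge0.
- by apply: measurable_funeM.
rewrite -ge0_integralZl//; last 2 first.
- by apply: emeasurable_funD => //; apply: measurable_funeM.
- by move=> x _; rewrite adde_ge0// -?EFinM lee_fin ?mulr_ge0// powR_ge0.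
apply: ge0_le_lower_integral => x; first by rewrite lee_fin powR_ge0.
rewrite -[X in _ * (_ + X)]EFinM -EFinD -EFinM lee_fin -powRM//.
set a := `|u y|%R; set b := (L * d y x)%R.
have a0 : (0 <= a)%R by rewrite normr_ge0.
have b0 : (0 <= b)%R by rewrite mulr_ge0.
have uab : (`|u x| <= 2 * Num.max a b)%R.
  have -> : u x = (u y + (u x - u y))%R by lra.
  apply: le_trans (ler_normD _ _) _.
  rewrite mulr_natl mulr2n; apply: lerD; first by rewrite le_max lexx.
  by rewrite le_max distrC Lu orbT.
have ab0 : (0 <= Num.max a b)%R by rewrite le_max a0.
apply: (@le_trans _ _ ((2 * Num.max a b) `^ p)%R).
  by apply: ge0_ler_powR; rewrite ?nnegrE ?mulr_ge0.
rewrite powRM//; apply: ler_wpM2l; first exact: powR_ge0.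
by rewrite maxEle; case: ifP => _; rewrite ?lerDl ?lerDr powR_ge0.
Qed.

(** t <= 1 + t^p for t >= 0, since p >= 1. *)
Lemma dist_integrable (pi : probability T R) (p : R) x0 :
  (1 <= p)%R -> measurable_fun setT (d x0) -> eccentricity d pi p x0 < +oo ->
  pi.-integrable setT (EFin \o d x0).
Proof.
move=> p1 md Ep.
have mdp : measurable_fun setT (fun x => (d x0 x `^ p)%:E).
  by apply/measurable_EFinP; exact: (measurableT_comp (measurable_powR p)).
have idp : pi.-integrable setT (EFin \o (fun x => d x0 x `^ p)%R).
  apply/integrableP; split=> //=.
  by under eq_integral do rewrite ger0_norm ?powR_ge0//.
have := integrableD measurableT
  (finite_measure_integrable_cst pi 1%R measurableT) idp.
apply: le_integrable => //; first exact/measurable_EFinP.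
move=> x _ /=; rewrite lee_fin [leRHS]ger0_norm ?addr_ge0 ?powR_ge0//.
rewrite ger0_norm//; have [d1|d1] := leP (d x0 x) 1%R.
  by apply: le_trans d1 _; rewrite lerDl powR_ge0.
apply: (@le_trans _ _ (d x0 x `^ p)%R); last by rewrite lerDr.
by rewrite -[leLHS]powRr1// ler_powR// ltW.
Qed.

End lipschitz_norm.

(** The strict superlevel sets of a section of [d] are open for [rho], as
    preimages of open sets under y |-> (x, y). *)
Lemma lsc_measurable_section (R : realType) (disp : measure_display)
    (X : polishBorelType disp R) (d : X -> X -> R) :
  lower_semicontinuous (fun z : X * X => (d z.1 z.2)%:E) ->
  forall x, measurable_fun setT (d x).
Proof.
move=> /lower_semicontinuousP d_lsc x.
apply/measurable_EFinP.
apply: (measurability _ (ErealGenOInfty.measurableE R)).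
move=> /= _ [_ [a ->]] <-; rewrite setTI polish_borelE.
apply: sub_sigma_algebra; rewrite preimage_itvoy.
have := d_lsc a; apply: (@open_comp _ _ (fun y => (x, y))) => y _.
by apply: cvg_pair => //=; exact: cvg_cst.
Qed.

(** * Poisson's equation *)

(** Once the integrals are finite, the equation between extended reals is one
    between real numbers. *)
Lemma poisson_solutionE (disp : measure_display) (T : measurableType disp)
    (R : realType) (P : R.-pker T ~> T) (pi : probability T R) (f u : T -> R) :
  \int[pi]_x (f x)%:E = 0 ->
  (forall x, (P x).-integrable setT (EFin \o u)) ->
  poisson_solution P pi f u <-> forall x, markov_op P u x = (u x - f x)%R.
Proof.
move=> f0 Pu.
have PuE x : \int[P x]_y (u y)%:E = (markov_op P u x)%:E.
  by rewrite /markov_op fineK//; exact: integrable_fin_num (Pu x).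
split=> h x; have := h x; rewrite PuE f0 sube0 -EFinB.
  by move=> [<-]; lra.
by move=> ->; congr EFin; lra.
Qed.

Theorem theorem3p4 (R : realType) (disp : measure_display)
    (X : polishBorelType disp R) (d : X -> X -> R)
    (P : R.-pker X ~> X) (pi : probability X R) (p : R)
    (X_nontrivial : exists x y : X, x <> y)
    (d_metric : is_metric d)
    (d_lsc : lower_semicontinuous (fun z : X * X => (d z.1 z.2)%:E))
    (p_ge1 : (1 <= p)%R)
    (E_fin : exists x0 : X, eccentricity d pi p x0 < +oo)
    (P_contractive : wasserstein_contractive d P)
    (pi_inv : unique_invariant_distribution P pi)
    (f : X -> R) (f_L0 : lip_space0 d pi f) :
  (exists! u : X -> R, lip_space0 d pi u /\ poisson_solution P pi f u) /\
  (forall u : X -> R, lip_space0 d pi u -> poisson_solution P pi f u ->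
    [/\ lip_norm d u <= wasserstein_sum d P * lip_norm d f,
        \int[pi]_x (`|u x| `^ p)%:E <=
          (2 `^ p)%:E * ereal_inf [set (`|u y| `^ p)%:E
                          + poweR (lip_norm d u) p * eccentricity d pi p y
                        | y in [set: X]]
      & (2 `^ p)%:E * ereal_inf [set (`|u y| `^ p)%:E
                          + poweR (lip_norm d u) p * eccentricity d pi p y
                        | y in [set: X]] < +oo]).
Proof.
have [x0 Ex0] := E_fin.
have md := lsc_measurable_section d_lsc.
have d_ge0 x y : (0 <= d x y)%R by case: d_metric.
have pi_moment := dist_integrable d_metric p_ge1 (md x0) Ex0.
have [P_fin [m m1 Pm]] := P_contractive.
have P_moment := kernel_moment d_metric (md x0) P_fin pi_inv.1 pi_moment.
have [M [rho [M0 rho01 geo]]] :=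
  markov_iter_geometric d_metric X_nontrivial P_fin P_moment m1 Pm.
have [f_lip f_mean] := f_L0.
have [L0 LE Lf] := lip_spaceP d_metric X_nontrivial f_lip.
have f0 : (\int[pi]_x f x)%R = 0%R by rewrite /Rintegral f_mean.
pose u := potential P f.
have Lu : lipschitz_with d _ u :=
  potential_lipschitz d_metric (md x0) P_fin pi_inv.1 pi_moment M0 rho01 geo
    L0 Lf f0.
have u_mean : (\int[pi]_x u x)%R = 0%R :=
  potential_mean d_metric (md x0) P_fin pi_inv.1 pi_moment M0 rho01 geo
    L0 Lf f0.
have mean0 v : lip_space d v -> (\int[pi]_x v x)%R = 0%R ->
    \int[pi]_x (v x)%:E = 0.
  move=> /(lip_spaceP d_metric X_nontrivial)[_ _ Lv] v0.
  by rewrite -[RHS]/(0%R%:E) -v0 fineK//;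
    exact: integrable_fin_num (lipschitz_integrable pi_moment Lv).
have u_lip := lipschitz_with_lip_space d_metric Lu.
have u_L0 : lip_space0 d pi u by split; last exact: mean0.
have u_sol : poisson_solution P pi f u.
  apply/poisson_solutionE => // [x|x].
    exact: (lipschitz_integrable_kernel P_moment x Lu).
  exact: (potential_poisson d_metric (md x0) P_fin pi_inv.1 pi_moment M0 rho01
    geo L0 Lf f0).
have uniq v : lip_space0 d pi v -> poisson_solution P pi f v -> v = u.
  move=> [v_lip v_mean] v_sol.
  have [Lv0 _ Lv] := lip_spaceP d_metric X_nontrivial v_lip.
  have [Lu0 _ Lu'] := lip_spaceP d_metric X_nontrivial u_lip.
  have iv x := lipschitz_integrable_kernel P_moment x Lv.
  have iu x := lipschitz_integrable_kernel P_moment x Lu'.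
  have /poisson_solutionE Pv := v_sol; have /poisson_solutionE Pu := u_sol.
  pose w := (fun x => v x - u x)%R.
  suff w0 : w = cst 0%R.
    by apply/funext => x; apply/eqP; rewrite -subr_eq0 -[(_ - _)%R]/(w x) w0.
  apply: (harmonic_lipschitz_eq0 pi_moment rho01 geo
    (L := (fine (lip_norm d v) + fine (lip_norm d u))%R)).
  - by rewrite addr_ge0.
  - split=> [|x y]; first exact: measurable_funB Lv.1 Lu'.1.
    have -> : (w x - w y = (v x - v y) - (u x - u y))%R by rewrite /w; lra.
    apply: le_trans (ler_normB _ _) _; rewrite mulrDl.
    by apply: lerD; [exact: Lv.2|exact: Lu'.2].
  - rewrite /w RintegralB//.
    + by rewrite u_mean subr0 /Rintegral v_mean.
    + exact: lipschitz_integrable pi_moment Lv.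
    + exact: lipschitz_integrable pi_moment Lu'.
  - apply/funext => x; rewrite /markov_op RintegralB//.
    by rewrite -!/(markov_op P _ _) Pv// Pu// /w; lra.
split; first by exists u; split=> // v [v0 v_sol]; rewrite (uniq v).
move=> v v0 v_sol; rewrite (uniq v)// => {v v0 v_sol}.
have [K0 KE LK] := lip_spaceP d_metric X_nontrivial u_lip.
have two_p : (0 < 2 `^ p :> R)%R by rewrite powR_gt0.
split.
- apply: lip_norm_le => // x y; rewrite LE -muleA -EFinM.
  exact: (potential_dist_le_wasserstein_sum d_metric (md x0) X_nontrivial P_fin
    pi_inv.1 pi_moment M0 rho01 geo L0 Lf f0).
- rewrite -lee_pdivrMl//; apply/ereal_infP => _ [y _ <-].
  by rewrite lee_pdivrMl// KE poweR_EFin; exact: lipschitz_moment_le.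
- apply: (@le_lt_trans _ _ ((2 `^ p)%:E * ((`|u x0| `^ p)%:E +
      poweR (lip_norm d u) p * eccentricity d pi p x0))).
    apply: lee_wpmul2l; first by rewrite lee_fin ltW.
    by apply: ereal_inf_lbound; exists x0.
  have /fineK <- : eccentricity d pi p x0 \is a fin_num.
    by rewrite ge0_fin_numE// integral_ge0// => y _; rewrite lee_fin powR_ge0.
  by rewrite KE poweR_EFin -[X in _ * (_ + X)]EFinM -EFinD -EFinM ltry.
Qed.
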